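(* Let $\mathbb F$ be a field of characteristic different from $2$ and let $n\in\mathbb N$. Let $M_n(\mathbb F)$ be the algebra of $n\times n$ matrices over $\mathbb F$ and let $I_1(\mathbb F^n)$ be the set of all rank-one idempotents in $M_n(\mathbb F)$. Suppose $\phi: I_1(\mathbb F^n)\to I_1(\mathbb F^n)$ is a transformation with the property that \[ \operatorname{tr}\phi(P)\phi(Q)=\operatorname{tr} PQ \qquad (P,Q\in I_1(\mathbb F^n)). \] Then there exists a nonsingular matrix $A\in M_n(\mathbb F)$ such that $\phi$ is either of the form \[ \phi(P)=APA^{-1}\qquad (P\in I_1(\mathbb F^n)) \] or of the form \[ \phi(P)=AP^{t}A^{-1}\qquad (P\in I_1(\mathbb F^n)). \]
   Context: Here $\operatorname{tr}$ is the usual matrix trace and $P^t$ denotes the transpose of $P$. The map $\phi$ is an arbitrary function; it is not assumed to be injective, surjective or linear. *)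

(* Defs.v *)
From HB Require Import structures.
From mathcomp Require Import all_boot all_order all_algebra.

Set Implicit Arguments.
Unset Strict Implicit.
Unset Printing Implicit Defensive.

Import GRing.Theory.
Local Open Scope ring_scope.

Definition is_rank1_idempotent (F : fieldType) (n : nat) (P : 'M[F]_n) : bool :=
  (P *m P == P) && (\rank P == 1%N).

(* The set I_1(F^n), as a subtype of 'M[F]_n. *)
Record rank1_idempotent (F : fieldType) (n : nat) := Rank1Idempotent {
  rank1_idempotent_mx :> 'M[F]_n;
  rank1_idempotentP : is_rank1_idempotent rank1_idempotent_mx
}.

HB.instance Definition _ (F : fieldType) (n : nat) :=
  [isSub for @rank1_idempotent_mx F n].
HB.instance Definition _ (F : fieldType) (n : nat) :=
  [Choice of rank1_idempotent F n by <:].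

(* Main.v *)
From HB Require Import structures.
Require Import Defs.
From mathcomp Require Import all_boot all_order all_algebra.

Set Implicit Arguments.
Unset Strict Implicit.
Unset Printing Implicit Defensive.

Import GRing.Theory.
Local Open Scope ring_scope.

(* The rank-one idempotents span M_n and the trace form is nondegenerate, so phi
   extends to a linear bijection Phi preserving the trace form.  Let e be the
   first basis vector and Phi(E_00) = x y.  If v is a row vector with v_0 = 0,
   then E_00 + e v and E_00 - e v are rank-one idempotents; comparing their
   images, N = Phi(e v) satisfies N = x (y N) + (N x) y with N x = 0 or y N = 0,
   and linearity makes the alternative uniform in v.  After transposing Phi if
   necessary, N x = 0 throughout.  Then the vectors Phi(E_i0) x form a basis, and
   in this basis Phi fixes the first row and column of every matrix.  A rank-one
   matrix with nonzero (0, 0) entry is determined by its first row and column,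
   and pairing with the idempotents proportional to (e_0 + e_i)(e_0 + e_j)^t
   recovers the remaining entries. *)

(** * Outer products and rank-one idempotents *)

Lemma mxtrace_outer (R : comNzRingType) n (u : 'cV[R]_n) (v : 'rV[R]_n) :
  \tr (u *m v) = (v *m u) 0 0.
Proof. by rewrite mxtrace_mulC trace_mx11. Qed.

Lemma mxtrace_mul_delta (R : comNzRingType) n (X : 'M[R]_n) i j :
  \tr (X *m delta_mx i j) = X j i.
Proof.
rewrite -(mul_delta_mx (0 : 'I_1)) mulmxA mxtrace_outer mulmxA.
by rewrite -rowE -colE !mxE.
Qed.

Lemma eq_mx_trace (R : comNzRingType) n (X Y : 'M[R]_n) :
  (forall Z, \tr (X *m Z) = \tr (Y *m Z)) -> X = Y.
Proof. by move=> eqXY; apply/matrixP=> i j; rewrite -!mxtrace_mul_delta. Qed.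

Lemma rank1_idempotent_outer (F : fieldType) n (u : 'cV[F]_n) (v : 'rV[F]_n) :
  v *m u = 1%:M -> is_rank1_idempotent (u *m v).
Proof.
move=> vu1; rewrite /is_rank1_idempotent mulmxA -[_ *m v *m u]mulmxA vu1 mulmx1.
rewrite eqxx eqn_leq (leq_trans (mxrankM_maxl _ _) (rank_leq_col _)) lt0n.
rewrite mxrank_eq0; apply/eqP => uv0; have := mxtrace_outer u v.
by rewrite uv0 vu1 mxtrace0 mxE eqxx => /esym/eqP; rewrite oner_eq0.
Qed.

(** A rank factorisation provides [u] and [v]; then P = P^2 = (v u) P with P nonzero forces the
    scalar v u to be 1. *)
Lemma outer_rank1_idempotent (F : fieldType) n (P : 'M[F]_n) :
  is_rank1_idempotent P ->
  exists (u : 'cV[F]_n) (v : 'rV[F]_n), P = u *m v /\ v *m u = 1%:M.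
Proof.
case/andP=> /eqP PP /eqP rP.
have [u [v defP]] : exists (u : 'cV[F]_n) (v : 'rV[F]_n), P = u *m v.
  move: (col_base P) (row_base P) (mulmx_base P); rewrite rP => u v <-.
  by exists u, v.
exists u, v; split=> //.
have nzP : P != 0 by rewrite -mxrank_eq0 rP.
have : (v *m u) 0 0 *: P = P.
  by rewrite -{2}PP defP mulmxA -(mulmxA u) [X in _ = _ *m X *m _]mx11_scalar
    mul_mx_scalar scalemxAl.
move/eqP; rewrite -subr_eq0 -{2}[P]scale1r -scalerBl scaler_eq0 (negPf nzP) orbF.
by rewrite subr_eq0 => /eqP vu1; rewrite [LHS]mx11_scalar vu1.
Qed.

(** Scalars commute, so (b x)(y a) = (y a)(b x) = y M x = 1. A rank-one matrix is thus recovered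
    from one combination of its columns and one of its rows. *)
Lemma outer_sandwich (R : comNzRingType) n (M : 'M[R]_n)
    (a x : 'cV[R]_n) (b y : 'rV[R]_n) :
  M = a *m b -> y *m M *m x = 1%:M -> M = M *m x *m (y *m M).
Proof.
move=> -> yMx; have -> : a *m b *m x *m (y *m (a *m b))
    = a *m ((b *m x) *m (y *m a)) *m b by rewrite !mulmxA.
suff -> : (b *m x) *m (y *m a) = 1%:M by rewrite mulmx1.
rewrite -yMx !mulmxA -[RHS]mulmxA -[LHS]mulmxA.
by rewrite [b *m x]mx11_scalar [y *m a]mx11_scalar -!scalar_mxM mulrC.
Qed.

Lemma outer_eq0 (F : fieldType) n (u : 'cV[F]_n) (v : 'rV[F]_n) :
  u *m v = 0 -> u = 0 \/ v = 0.
Proof.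
have [->|/cV0Pn[i nzi] uv0] := eqVneq u 0; [by left | right].
apply/rowP=> j; have /matrixP/(_ i j)/eqP := uv0.
by rewrite !mxE big_ord1 mulf_eq0 (negPf nzi) => /eqP; rewrite ord1.
Qed.

Lemma outer_minor (R : comNzRingType) m n (M : 'M[R]_(m, n))
    (a : 'cV_m) (b : 'rV_n) i j k l :
  M = a *m b :> 'M_(m, n) -> M i j * M k l = M i l * M k j :> R.
Proof.
by move=> ->; rewrite !mxE !big_ord1 mulrACA [RHS]mulrACA [b _ j * _]mulrC.
Qed.

(** * Perturbations of a rank-one idempotent *)

Lemma outer_perturb1 (R : comNzRingType) n (N : 'M[R]_n)
    (a x : 'cV[R]_n) (b y : 'rV[R]_n) :
    y *m x = 1%:M -> y *m N *m x = 0 -> x *m y + N = a *m b ->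
  N = x *m (y *m N) + N *m x *m y + N *m x *m (y *m N).
Proof.
(* Sandwiching gives x y + N = (x + N x)(y + y N); expand and cancel x y. *)
move=> yx yNx /(@outer_sandwich _ _ _ _ x _ y).
rewrite mulmxDr !mulmxDl !mulmxA yx mul1mx yx yNx addr0 => /(_ erefl).
rewrite -[x *m y *m x]mulmxA yx mulmx1 !mulmxDr !mulmxA -!addrA.
by move/addrI.
Qed.

(** Adding the expansions for N and -N cancels the linear terms and leaves 2 (N x)(y N) = 0, where 2
    is invertible. *)
Lemma outer_perturb (F : fieldType) n (N : 'M[F]_n)
    (a a' x : 'cV[F]_n) (b b' y : 'rV[F]_n) :
    2%N \notin [pchar F] -> y *m x = 1%:M -> y *m N *m x = 0 ->
    x *m y + N = a *m b -> x *m y - N = a' *m b' ->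
  N = x *m (y *m N) + N *m x *m y /\ (N *m x = 0 \/ y *m N = 0).
Proof.
move=> hF yx yNx /(outer_perturb1 yx yNx) EN.
have yN'x : y *m - N *m x = 0 by rewrite mulmxN mulNmx yNx oppr0.
move=> /(outer_perturb1 yx yN'x); rewrite !mulNmx !mulmxN opprK => EN'.
have /outer_eq0 Nxy : N *m x *m (y *m N) = 0.
  have nz2 : 2%:R != 0 :> F by apply: contra hF; rewrite inE.
  move: (congr2 +%R EN EN'); rewrite subrr addrACA -opprD subrr add0r => /esym/eqP.
  by rewrite -mulr2n -scaler_nat scaler_eq0 (negPf nz2) => /eqP.
by split=> //; rewrite {1}EN; case: Nxy => ->; rewrite ?mul0mx ?mulmx0 addr0.
Qed.

(** * Reconstruction from the first row and column *)

Lemma corner_conj (F : fieldType) n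
    (Phi : {linear 'M[F]_n.+1 -> 'M[F]_n.+1})
    (x : 'cV[F]_n.+1) (y : 'rV[F]_n.+1) (z : 'I_n.+1 -> 'cV[F]_n.+1)
    (w : 'I_n.+1 -> 'rV[F]_n.+1) :
    2%N \notin [pchar F] ->
    (forall X Y, \tr (Phi X *m Phi Y) = \tr (X *m Y)) ->
    (forall (u : 'cV_n.+1) (v : 'rV_n.+1), v *m u = 1%:M ->
      exists (a : 'cV_n.+1) (b : 'rV_n.+1), Phi (u *m v) = a *m b /\ b *m a = 1%:M) ->
    y *m x = 1%:M -> z 0 = x -> w 0 = y ->
    (forall i, Phi (delta_mx i 0) = z i *m y) ->
    (forall i, Phi (delta_mx 0 i) = x *m w i) ->
  exists2 A, A \in unitmx & forall X, Phi X = A *m X *m invmx A.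
Proof.
move=> hF trPhi rkPhi yx z0 w0 Phiz Phiw.
pose A := \matrix_(i, j) z j i 0; pose W := \matrix_i w i.
have colA j : col j A = z j by apply/colP=> i; rewrite !mxE.
have rowW i : row i W = w i by rewrite rowK.
have entry Y i j : (W *m Y *m A) i j = (w i *m Y *m z j) 0 0.
  by rewrite -colA -rowW -row_mul colE mulmxA -row_mul -colE !mxE.
have WA : W *m A = 1%:M.
  apply/matrixP=> i j; have := entry 1%:M i j; rewrite !mulmx1 => ->.
  (* This is the trace of Phi(E_0i) Phi(E_j0), hence that of E_0i E_j0. *)
  have -> : (w i *m z j) 0 0 = \tr (x *m w i *m (z j *m y)).
    by rewrite -mulmxA mxtrace_outer -!mulmxA yx mulmx1.
  rewrite -Phiw -Phiz trPhi.
  by rewrite mxtrace_mul_delta !mxE eqxx eq_sym.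
have AW := mulmx1C WA.
pose Psi X := W *m Phi X *m A.
have trPsi X Y : \tr (Psi X *m Psi Y) = \tr (X *m Y).
  rewrite /Psi -mulmxA mxtrace_mulC !mulmxA AW mul1mx.
  by rewrite -(mulmxA _ A W) AW mulmx1 mxtrace_mulC trPhi.
(* The (0, j) entry is y (Phi X) z_j, the trace of Phi X against z_j y = Phi(E_j0). *)
have Psi0j X j : Psi X 0 j = X 0 j.
  by rewrite entry w0 -mulmxA -mxtrace_outer -mulmxA -Phiz trPhi mxtrace_mul_delta.
have Psii0 X i : Psi X i 0 = X i 0.
  by rewrite entry z0 -mulmxA -mxtrace_outer -mulmxA -Phiw trPhi mxtrace_mul_delta.
have Psi_outer (u : 'cV_n.+1) (v : 'rV_n.+1) :
    v *m u = 1%:M -> u 0 0 != 0 -> v 0 0 != 0 -> Psi (u *m v) = u *m v.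
  move=> vu nzu nzv; have [a [b [def_ab _]]] := rkPhi u v vu.
  have nz : (u *m v) 0 0 != 0 by rewrite !mxE big_ord1 mulf_neq0.
  have Psi_ab : Psi (u *m v) = (W *m a) *m (b *m A) by rewrite /Psi def_ab !mulmxA.
  apply/matrixP=> i j; apply: (mulIf nz); rewrite -{1}(Psi0j (u *m v)).
  rewrite (outer_minor _ _ _ _ Psi_ab) Psii0 Psi0j.
  exact: esym (outer_minor _ _ _ _ (erefl (u *m v))).
have PsiE X : Psi X = W *m Phi X *m A by [].
clearbody Psi; have PsiK X : Psi X = X.
  apply/matrixP=> j i; have [->|nzj] := eqVneq j 0; first exact: Psi0j.
  have [->|nzi] := eqVneq i 0; first exact: Psii0.
  pose u : 'cV[F]_n.+1 := delta_mx 0 0 + delta_mx i 0.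
  pose v : 'rV[F]_n.+1 := delta_mx 0 0 + delta_mx 0 j.
  have vMu (M : 'M_n.+1) : (v *m M *m u) 0 0 = M 0 0 + M 0 i + (M j 0 + M j i).
    by rewrite mulmxDl mulmxDr !mulmxDl -!rowE -!colE !mxE addrACA.
  (* The scalar v u is 1 for j different from i, and 2 for j = i. *)
  have nzc : (v *m u) 0 0 != 0.
    have := vMu 1%:M; rewrite mulmx1 => ->; rewrite !mxE eqxx.
    rewrite ![0 == _]eq_sym (negPf nzi) (negPf nzj) mulr0n addr0 add0r.
    have [_|_] := eqVneq j i; last by rewrite mulr0n addr0 oner_neq0.
    by apply: contra hF; rewrite inE.
  pose c := ((v *m u) 0 0)^-1.
  have cvu : (c *: v) *m u = 1%:M.
    by rewrite -scalemxAl [v *m u]mx11_scalar scale_scalar_mx mulVf.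
  have P : Psi (u *m (c *: v)) = u *m (c *: v).
    apply: Psi_outer => //; rewrite !mxE !eqxx /=.
      by rewrite [0 == i]eq_sym (negPf nzi) addr0 oner_neq0.
    by rewrite [0 == j]eq_sym (negPf nzj) addr0 mulr1 invr_neq0.
  (* Pairing X with u (c v) gives c (X_00 + X_0i + X_j0 + X_ji), and likewise for Psi X. The first
     three terms already agree, hence so does the last. *)
  have := trPsi X (u *m (c *: v)); rewrite P !mulmxA !mxtrace_outer.
  have cE (M : 'M_1) : (c *: M) 0 0 = c * M 0 0 by rewrite mxE.
  rewrite -!scalemxAl !cE !mulmxA => /(mulfI (invr_neq0 nzc)).
  by rewrite !vMu !Psi0j !Psii0 => /addrI /addrI.
have uA : A \in unitmx by case: (mulmx1_unit WA).
exists A => // X; rewrite -{2}(PsiK X) PsiE !mulmxA AW mul1mx.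
by rewrite mulmxK.
Qed.

(** * Images of the matrix units in the first row and column *)

Lemma corner_perturb (F : fieldType) n
    (Phi : {linear 'M[F]_n.+1 -> 'M[F]_n.+1})
    (x : 'cV[F]_n.+1) (y : 'rV[F]_n.+1) (Z N : 'M[F]_n.+1)
    (u u' : 'cV_n.+1) (v v' : 'rV_n.+1) :
    2%N \notin [pchar F] ->
    (forall X Y, \tr (Phi X *m Phi Y) = \tr (X *m Y)) ->
    (forall (u : 'cV_n.+1) (v : 'rV_n.+1), v *m u = 1%:M ->
      exists (a : 'cV_n.+1) (b : 'rV_n.+1), Phi (u *m v) = a *m b /\ b *m a = 1%:M) ->
    y *m x = 1%:M -> Phi (delta_mx 0 0) = x *m y ->
    Z 0 0 = 0 ->
    delta_mx 0 0 + Z = u *m v -> v *m u = 1%:M ->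
    delta_mx 0 0 - Z = u' *m v' -> v' *m u' = 1%:M -> N = Phi Z ->
  N = x *m (y *m N) + N *m x *m y /\ (N *m x = 0 \/ y *m N = 0).
Proof.
move=> hF trPhi rkPhi yx Phi00 Z00 defP vu defP' vu' ->.
(* The scalar is the trace of Phi Z against x y = Phi(E_00), that is, Z_00. *)
have yNx : y *m Phi Z *m x = 0.
  apply/matrixP=> i j; rewrite !ord1 -mxtrace_outer mulmxA -Phi00 trPhi.
  by rewrite mxtrace_mulC mxtrace_mul_delta Z00 mxE.
have [a [b [Pab _]]] := rkPhi _ _ vu; have [a' [b' [Pab' _]]] := rkPhi _ _ vu'.
by apply: (outer_perturb (a := a) (b := b) (a' := a') (b' := b')) => //;
  rewrite -Phi00 -?linearD -?linearB ?defP ?defP'.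
Qed.

Lemma corner_row_perturb (F : fieldType) n
    (Phi : {linear 'M[F]_n.+1 -> 'M[F]_n.+1})
    (x : 'cV[F]_n.+1) (y : 'rV[F]_n.+1) (v : 'rV_n.+1) :
    2%N \notin [pchar F] ->
    (forall X Y, \tr (Phi X *m Phi Y) = \tr (X *m Y)) ->
    (forall (u : 'cV_n.+1) (v : 'rV_n.+1), v *m u = 1%:M ->
      exists (a : 'cV_n.+1) (b : 'rV_n.+1), Phi (u *m v) = a *m b /\ b *m a = 1%:M) ->
    y *m x = 1%:M -> Phi (delta_mx 0 0) = x *m y ->
    v 0 0 = 0 -> forall N : 'M_n.+1, N = Phi (delta_mx 0 0 *m v) ->
  N = x *m (y *m N) + N *m x *m y /\ (N *m x = 0 \/ y *m N = 0).
Proof.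
move=> hF trPhi rkPhi yx Phi00 v0 N defN.
(* Both signs at once: E_00 + c e_0 v factors as e_0 (e_0^t + c v), taken below at c = 1 and c =
   -1. *)
have v1 (c : F) : (delta_mx 0 0 + c *: v) *m (delta_mx 0 0 : 'cV_n.+1) = 1%:M.
  by rewrite -colE; apply/matrixP=> i j; rewrite !ord1 !mxE v0 mulr0 addr0.
have v00 : ((delta_mx 0 0 : 'cV_n.+1) *m v) 0 0 = 0.
  by rewrite !mxE big_ord1 v0 mulr0.
apply: (corner_perturb hF trPhi rkPhi yx Phi00 v00 _ (v1 1) _ (v1 (-1)) defN).
  by rewrite scale1r mulmxDr mul_delta_mx.
by rewrite scaleN1r mulmxBr mul_delta_mx.
Qed.

Lemma corner_col_perturb (F : fieldType) n
    (Phi : {linear 'M[F]_n.+1 -> 'M[F]_n.+1})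
    (x : 'cV[F]_n.+1) (y : 'rV[F]_n.+1) (u : 'cV_n.+1) :
    2%N \notin [pchar F] ->
    (forall X Y, \tr (Phi X *m Phi Y) = \tr (X *m Y)) ->
    (forall (u : 'cV_n.+1) (v : 'rV_n.+1), v *m u = 1%:M ->
      exists (a : 'cV_n.+1) (b : 'rV_n.+1), Phi (u *m v) = a *m b /\ b *m a = 1%:M) ->
    y *m x = 1%:M -> Phi (delta_mx 0 0) = x *m y ->
    u 0 0 = 0 -> forall N : 'M_n.+1, N = Phi (u *m delta_mx 0 0) ->
  N = x *m (y *m N) + N *m x *m y /\ (N *m x = 0 \/ y *m N = 0).
Proof.
move=> hF trPhi rkPhi yx Phi00 u0 N defN.
have u1 (c : F) : (delta_mx 0 0 : 'rV_n.+1) *m (delta_mx 0 0 + c *: u) = 1%:M.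
  by rewrite -rowE; apply/matrixP=> i j; rewrite !ord1 !mxE u0 mulr0 addr0.
have u00 : (u *m (delta_mx 0 0 : 'rV_n.+1)) 0 0 = 0.
  by rewrite !mxE big_ord1 u0 mul0r.
apply: (corner_perturb hF trPhi rkPhi yx Phi00 u00 _ (u1 1) _ (u1 (-1)) defN).
  by rewrite scale1r mulmxDl mul_delta_mx.
by rewrite scaleN1r mulmxBl mul_delta_mx.
Qed.

(** The hypothesis on the first row settles the first column too. For M = Phi(E_i0) with i nonzero,
    M x = 0 would make the trace of Phi(E_0i) M = x w_i M vanish, whereas E_0i E_i0 has trace 1. So
    y M = 0 and M = (M x) y. *)
Lemma corner_row_conj (F : fieldType) n
    (Phi : {linear 'M[F]_n.+1 -> 'M[F]_n.+1})
    (x : 'cV[F]_n.+1) (y : 'rV[F]_n.+1) :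
    2%N \notin [pchar F] ->
    (forall X Y, \tr (Phi X *m Phi Y) = \tr (X *m Y)) ->
    (forall (u : 'cV_n.+1) (v : 'rV_n.+1), v *m u = 1%:M ->
      exists (a : 'cV_n.+1) (b : 'rV_n.+1), Phi (u *m v) = a *m b /\ b *m a = 1%:M) ->
    y *m x = 1%:M -> Phi (delta_mx 0 0) = x *m y ->
    (forall i, i != 0 -> Phi (delta_mx 0 i) *m x = 0) ->
  exists2 A, A \in unitmx & forall X, Phi X = A *m X *m invmx A.
Proof.
move=> hF trPhi rkPhi yx Phi00 Phix0.
pose z j := Phi (delta_mx j 0) *m x; pose w i := y *m Phi (delta_mx 0 i).
have e0i i : i != 0 -> (delta_mx 0 i : 'rV[F]_n.+1) 0 0 = 0.
  by move=> nzi; rewrite mxE [0 == i]eq_sym (negPf nzi) andbF.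
have ei0 i : i != 0 -> (delta_mx i 0 : 'cV[F]_n.+1) 0 0 = 0.
  by move=> nzi; rewrite mxE [0 == i]eq_sym (negPf nzi).
have Phiw i : Phi (delta_mx 0 i) = x *m w i.
  have [->|nzi] := eqVneq i 0.
    by rewrite /w Phi00 !mulmxA -(mulmxA x) yx mulmx1.
  have [defN _] := corner_row_perturb hF trPhi rkPhi yx Phi00 (e0i i nzi)
                (congr1 Phi (esym (mul_delta_mx _ _ _))).
  by rewrite [LHS]defN Phix0 // mul0mx addr0.
apply: (corner_conj (z := z) (w := w) hF trPhi rkPhi yx) => //.
- by rewrite /z Phi00 -mulmxA yx mulmx1.
- by rewrite /w Phi00 mulmxA yx mul1mx.
move=> i; rewrite /z; have [->|nzi] := eqVneq i 0.
  by rewrite Phi00 -(mulmxA x) yx mulmx1.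
have [defM [Mx0|yM0]] := corner_col_perturb hF trPhi rkPhi yx Phi00 (ei0 i nzi)
    (congr1 Phi (esym (mul_delta_mx _ _ _))); last first.
  by rewrite [LHS]defM yM0 mulmx0 add0r.
have := trPhi (delta_mx 0 i) (delta_mx i 0).
rewrite mxtrace_mul_delta Phiw -mulmxA mxtrace_outer -(mulmxA (w i)) Mx0 mulmx0.
rewrite !mxE !eqxx.
by move/esym/eqP; rewrite oner_eq0.
Qed.

Lemma trace_preserver_conj (F : fieldType) n
    (Phi : {linear 'M[F]_n.+1 -> 'M[F]_n.+1}) :
    2%N \notin [pchar F] ->
    (forall X Y, \tr (Phi X *m Phi Y) = \tr (X *m Y)) ->
    (forall (u : 'cV_n.+1) (v : 'rV_n.+1), v *m u = 1%:M ->
      exists (a : 'cV_n.+1) (b : 'rV_n.+1), Phi (u *m v) = a *m b /\ b *m a = 1%:M) ->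
  exists2 A, A \in unitmx &
    (forall X, Phi X = A *m X *m invmx A) \/
    (forall X, Phi X = A *m X^T *m invmx A).
Proof.
move=> hF trPhi rkPhi.
have d00 : (delta_mx 0 0 : 'rV_n.+1) *m (delta_mx 0 0 : 'cV_n.+1) = 1%:M :> 'M[F]_1.
  by rewrite mul_delta_mx; apply/matrixP=> i j; rewrite !ord1 !mxE.
have [x [y []]] := rkPhi _ _ d00; rewrite mul_delta_mx => Phi00 yx.
pose N i := Phi (delta_mx 0 i).
have [/forallP Nx0|] := boolP [forall i, (i != 0) ==> (N i *m x == 0)].
  have [//|A uA PhiA] := corner_row_conj hF trPhi rkPhi yx Phi00 (x := x).
    by move=> i nzi; apply/eqP; apply: (implyP (Nx0 i)).
  by exists A => //; left.
rewrite negb_forall => /existsP[i]; rewrite negb_imply => /andP[nzi /eqP nzNx].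
have dich (v : 'rV_n.+1) : v 0 0 = 0 ->
    Phi (delta_mx 0 0 *m v) *m x = 0 \/ y *m Phi (delta_mx 0 0 *m v) = 0.
  by move=> v0; have [] := corner_row_perturb hF trPhi rkPhi yx Phi00 v0 erefl.
have e0i j : j != 0 -> (delta_mx 0 j : 'rV[F]_n.+1) 0 0 = 0.
  by move=> nzj; rewrite mxE [0 == j]eq_sym (negPf nzj) andbF.
have dichN j : j != 0 -> N j *m x = 0 \/ y *m N j = 0.
  by move=> nzj; rewrite /N -(mul_delta_mx (0 : 'I_1)); apply/dich/e0i.
have yNi : y *m N i = 0 by case: (dichN i nzi).
have yN j : j != 0 -> y *m N j = 0.
  move=> nzj; case: (dichN j nzj) => // Njx.
  (* The image N_i + N_j of this row sends x to N_i x, which is nonzero, so y annihilates it; since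
     y N_i = 0, also y N_j = 0. *)
  have := dich (delta_mx 0 i + delta_mx 0 j).
  rewrite mulmxDr !mul_delta_mx linearD mulmxDl mulmxDr -/(N i) -/(N j).
  by rewrite Njx yNi addr0 add0r mxE !e0i // addr0 => -[].
(* As y N_j = 0 for all nonzero j, transposing puts [y^T] in the role of x. *)
pose PhiT : {linear 'M[F]_n.+1 -> 'M[F]_n.+1} := trmx \o Phi.
have [|||||A uA PhiA] := @corner_row_conj _ _ PhiT y^T x^T hF.
- by move=> X Y; rewrite /= -trmx_mul mxtrace_tr mxtrace_mulC trPhi.
- move=> u v /rkPhi[a [b [PhiE ba]]]; exists b^T, a^T.
  by rewrite /= PhiE -!trmx_mul ba trmx1.
- by rewrite -trmx_mul yx trmx1.
- by rewrite /= Phi00 trmx_mul.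
- by move=> j /yN yNj; rewrite /= -trmx_mul yNj trmx0.
(* Transposing A X A^-1 yields the conjugate of X^T by the inverse transpose of A. *)
exists (invmx A)^T; first by rewrite unitmx_tr unitmx_inv.
right=> X; rewrite -[LHS]trmxK -[(Phi X)^T]/(PhiT X) PhiA !trmx_mul mulmxA.
by rewrite !trmx_inv invmxK.
Qed.

(** * Linear extension of [phi] *)

Lemma linear_extension (F : fieldType) n
    (phi : rank1_idempotent F n -> rank1_idempotent F n) :
    (forall P Q : rank1_idempotent F n,
       \tr (phi P *m phi Q) = \tr (P *m Q)) ->
  exists Phi : {linear 'M[F]_n -> 'M[F]_n},
    (forall P : rank1_idempotent F n, phi P = Phi P :> 'M_n) /\
    (forall X Y, \tr (Phi X *m Phi Y) = \tr (X *m Y)).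
Proof.
move=> hphi.
(* These are e_i (e_i + e_j)^t, or E_ii when i = j. *)
have G_idem i j : is_rank1_idempotent
    (delta_mx i i + (delta_mx i j *+ (i != j)) : 'M[F]_n).
  have -> : delta_mx i i + (delta_mx i j *+ (i != j)) =
      (delta_mx i 0 : 'cV_n) *m (delta_mx 0 i + delta_mx 0 j *+ (i != j)) :> 'M[F]_n.
    by rewrite mulmxDr linearMn /= !mul_delta_mx.
  apply: rank1_idempotent_outer; rewrite -colE; apply/matrixP=> k l.
  rewrite !ord1 !mxE eqxx /=; case: (eqVneq i j) => [_|/negPf neij].
    by rewrite mulr0n mxE addr0 eqxx.
  by rewrite mulr1n mxE neij andbF addr0 eqxx.
pose G i j := Rank1Idempotent (G_idem i j).
(* E_ij is the difference of the idempotents E_ii + E_ij and E_ii. *)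
pose psi i j : 'M[F]_n :=
  (phi (G i j) : 'M_n) - if i == j then 0 else (phi (G i i) : 'M_n).
have psiP P i j : \tr (phi P *m psi i j) = P j i.
  rewrite /psi mulmxBr raddfB /= hphi /= mulmxDr raddfD /= mxtrace_mul_delta.
  have [->|neij] := eqVneq i j.
    by rewrite mulr0n !mulmx0 !mxtrace0 subr0 addr0.
  by rewrite mulr1n hphi /= eqxx mulr0n addr0 !mxtrace_mul_delta addrC addKr.
(* The [psi i j] have the same Gram matrix for the trace form as the matrix units. *)
have psi_psi i j k l : \tr (psi i j *m psi k l) = (delta_mx i j : 'M[F]_n) l k.
  rewrite {1}/psi mulmxBl raddfB /= psiP /=.
  have [->|neij] := eqVneq i j; first by rewrite mul0mx mxtrace0 mulr0n addr0 subr0.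
  by rewrite psiP /= eqxx mulr0n mulr1n addr0 mxE addrAC subrr add0r.
pose f (X : 'M[F]_n) : 'M[F]_n := \sum_i \sum_j X i j *: psi i j.
have f_lin : linear f.
  move=> c X Y; rewrite /f scaler_sumr -big_split /=; apply: eq_bigr => i _.
  rewrite scaler_sumr -big_split /=; apply: eq_bigr => j _.
  by rewrite !mxE scalerDl scalerA.
pose Phi : {linear 'M[F]_n -> 'M[F]_n} :=
  HB.pack f (GRing.isLinear.Build F 'M[F]_n 'M[F]_n *:%R f f_lin).
have trPhi_psi X k l : \tr (Phi X *m psi k l) = X l k.
  rewrite [X in RHS]matrix_sum_delta /= /f mulmx_suml raddf_sum summxE.
  apply: eq_bigr => i _; rewrite mulmx_suml raddf_sum summxE.
  by apply: eq_bigr => j _; rewrite -scalemxAl /= mxtraceZ psi_psi !mxE.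
have trPhi X Y : \tr (Phi X *m Phi Y) = \tr (X *m Y).
  rewrite [Y in RHS]matrix_sum_delta [Phi Y]/= /f !mulmx_sumr !raddf_sum /=.
  apply: eq_bigr => i _; rewrite !mulmx_sumr !raddf_sum /=.
  apply: eq_bigr => j _; rewrite -!scalemxAr !mxtraceZ.
  by rewrite trPhi_psi mxtrace_mul_delta.
(* The entries of X are traces of Phi X against the [psi k l], so Phi is injective, hence bijective
   by dimension. *)
have Phi_surj Y : exists X, Phi X = Y.
  have uT : lin_mx Phi \in unitmx.
    rewrite -row_free_unit; apply: inj_row_free => v.
    rewrite -[v]vec_mxK mul_vec_lin => /(congr1 vec_mx).
    rewrite mxvecK linear0 => Phiv0.
    rewrite [vec_mx v](_ : _ = 0) ?linear0 //; apply/matrixP=> i j.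
    by rewrite -trPhi_psi Phiv0 mul0mx mxtrace0 mxE.
  exists (vec_mx (mxvec Y *m invmx (lin_mx Phi))).
  apply: (can_inj mxvecK).
  by rewrite -mul_vec_lin vec_mxK -mulmxA mulVmx ?mulmx1.
(* By surjectivity it suffices to test phi P against the matrices Phi Y, where both pairings reduce
   to the trace of P Y. *)
exists Phi; split=> // P; apply: eq_mx_trace => Z; have [Y <-] := Phi_surj Z.
rewrite trPhi /= /f [Y in RHS]matrix_sum_delta !mulmx_sumr !raddf_sum /=.
apply: eq_bigr => i _; rewrite !mulmx_sumr !raddf_sum /=.
apply: eq_bigr => j _; rewrite -!scalemxAr !mxtraceZ.
by rewrite psiP mxtrace_mul_delta.
Qed.

Theorem theorem2 (F : fieldType) (n : nat) (hF : 2%N \notin [pchar F])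
    (phi : rank1_idempotent F n -> rank1_idempotent F n)
    (hphi : forall P Q : rank1_idempotent F n,
        \tr (phi P *m phi Q) = \tr (P *m Q)) :
  exists2 A : 'M[F]_n, A \in unitmx &
    (forall P : rank1_idempotent F n,
        phi P = A *m P *m invmx A :> 'M[F]_n) \/
    (forall P : rank1_idempotent F n,
        phi P = A *m P^T *m invmx A :> 'M[F]_n).
Proof.
case: n phi hphi => [|n] phi hphi.
  (* In dimension 0 all matrices coincide; otherwise the index 0 is available. *)
  exists 1%:M; first exact: unitmx1.
  by left=> P; apply/matrixP=> [[]].
have [Phi [phiE trPhi]] := linear_extension hphi.
have [u v vu|A uA PhiA] := trace_preserver_conj hF trPhi.
  rewrite -(phiE (Rank1Idempotent (rank1_idempotent_outer vu))).
  exact/outer_rank1_idempotent/rank1_idempotentP.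
by exists A => //; case: PhiA => PhiA; [left | right] => P; rewrite phiE PhiA.
Qed.
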